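(* Let $m\ge 3$ and $l\ge 1$ be integers, and let $L(\mathrm{Tp}_{m,l})$ be the graph obtained from the disjoint union of a cycle $C_m$ on $m$ vertices and a path $P_l$ on $l$ vertices by adding the edges $uw$ and $vw$, where $u,v$ are two adjacent vertices of $C_m$ and $w$ is an end of $P_l$. Then $L(\mathrm{Tp}_{m,l})$ is $e$-positive.
   Context: For a finite simple graph $G$, the chromatic symmetric function is $X_G=\sum_\kappa\prod_{v\in V(G)}x_{\kappa(v)}$, where $x_1,x_2,\dots$ are commuting indeterminates and the sum is over all proper colorings $\kappa\colon V(G)\to\{1,2,3,\dots\}$. With $e_n=\sum_{1\le i_1<\dots<i_n}x_{i_1}\dotsm x_{i_n}$ and $e_\lambda=e_{\lambda_1}e_{\lambda_2}\dotsm$ for integer partitions $\lambda$, the $e_\lambda$ form a basis of the algebra of symmetric functions. The graph $G$ is called $e$-positive if all coefficients of $X_G$ in the basis $\{e_\lambda\}$ are nonnegative. The graph $L(\mathrm{Tp}_{m,l})$ is the line graph of the tadpole $\mathrm{Tp}_{m,l}$ consisting of a cycle of length $m$ with a pendant path having $l$ edges attached at one vertex of the cycle. *)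

(* Defs.v *)
From mathcomp Require Import all_boot all_order all_algebra.
From mathcomp Require Import finmap.
From mathcomp Require Import boolp classical_sets functions cardinality fsbigop.
From mathcomp Require Import monalg.
Set Implicit Arguments. Unset Strict Implicit. Unset Printing Implicit Defensive.
Import Order.TTheory GRing.Theory Num.Theory.
Local Open Scope classical_set_scope.
Local Open Scope ring_scope.

(** * Formal power series over [rat] in countably many commuting variables

    The variables are x_0, x_1, x_2, ... (indexed from 0 instead of 1); a series
    is given by its coefficients. *)

Definition monomial := {cmonom nat}.

Definition series := monomial -> rat.

(* The monomial x_(f i1) * x_(f i2) * ... over the indices i in [r]. *)
Definition monom_prod (I : Type) (r : seq I) (f : I -> nat) : monomial :=
  \big[mmul/mone]_(i <- r) ucm (f i).

(* The formal infinite sum of the monomials [mon i] for i in [D]: the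
   coefficient of [a] is the number of i in [D] with [mon i = a]. The library's
   [\sum_(i \in _)] would be 0 on an infinite set of such i; the sums below
   have finite fibres (see [finite_coloring_fiber] and
   [finite_tuple_fiber]). *)
Definition monom_sum (I : choiceType) (D : set I) (mon : I -> monomial) : series :=
  fun a => \sum_(i \in [set i | D i /\ mon i = a]) (1 : rat).

Definition series_one : series := fun a => (a == mone)%:R.

(* Cauchy product; a monomial has finitely many factorizations
   (see [finite_factorizations]). *)
Definition series_mul (f g : series) : series :=
  fun a => \sum_(p \in [set p : monomial * monomial | mmul p.1 p.2 = a])
             f p.1 * g p.2.

(** * Elementary symmetric functions *)

Definition elem (n : nat) : series :=
  monom_sum [set t : n.-tuple nat | sorted ltn t] (fun t => monom_prod t id).

(* Integer partitions: weakly decreasing sequences of positive integers. *)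
Definition is_intpart (s : seq nat) : bool := sorted geq s && (0%N \notin s).

Definition intpart := {s : seq nat | is_intpart s}.

Definition elem_part (la : intpart) : series :=
  \big[series_mul/series_one]_(k <- val la) elem k.

Definition is_e_expansion (f : series) (c : {fsfun intpart -> rat with 0}) : Prop :=
  forall a, f a = \sum_(la <- finsupp c) c la * elem_part la a.

Definition series_e_positive (f : series) : Prop :=
  exists c : {fsfun intpart -> rat with 0},
    is_e_expansion f c /\ forall la, 0 <= c la.

(** * Chromatic symmetric functions

    A finite simple graph is a symmetric irreflexive relation on a [finType]. *)

Definition proper_coloring (V : finType) (adj : rel V) (k : {ffun V -> nat}) : Prop :=
  forall x y, adj x y -> k x <> k y.

Definition chromatic_symfun (V : finType) (adj : rel V) : series :=
  monom_sum [set k : {ffun V -> nat} | proper_coloring adj k]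
    (fun k => monom_prod (enum V) k).

Definition e_positive (V : finType) (adj : rel V) : Prop :=
  series_e_positive (chromatic_symfun adj).

(** * The line graph of the tadpole *)

Definition cycle_adj (m : nat) : rel 'I_m :=
  fun i j => (j == ordS i) || (i == ordS j).

Definition path_adj (l : nat) : rel 'I_l :=
  fun i j => (j == i.+1 :> nat) || (i == j.+1 :> nat).

Definition path_end (l : nat) (i : 'I_l) : bool :=
  (i == 0%N :> nat) || (i.+1 == l).

Definition line_tadpole_adj (m l : nat) (u v : 'I_m) (w : 'I_l) :
    rel ('I_m + 'I_l)%type :=
  fun x y => match x, y with
  | inl i, inl j => cycle_adj i j
  | inr i, inr j => path_adj i j
  | inl i, inr j | inr j, inl i => ((i == u) || (i == v)) && (j == w)
  end.

Lemma line_tadpole_sym (m l : nat) (u v : 'I_m) (w : 'I_l) :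
  symmetric (line_tadpole_adj u v w).
Proof.
by move=> [i|i] [j|j] //=; rewrite /cycle_adj /path_adj orbC.
Qed.

Lemma line_tadpole_irrefl (m l : nat) (u v : 'I_m) (w : 'I_l) :
  (1 < m)%N -> irreflexive (line_tadpole_adj u v w).
Proof.
move=> m1 [i|i] /=; last by rewrite /path_adj orbb; apply/negbTE; rewrite neq_ltn ltnSn.
rewrite /cycle_adj orbb; apply/negbTE/eqP => /(congr1 val) /=.
have := ltn_ord i; rewrite leq_eqVlt => /orP[/eqP im|im].
  by rewrite im modnn => i0; move: m1; rewrite -im i0.
by rewrite modn_small // => /eqP; rewrite eqn_leq ltnn andbF.
Qed.

(** * Finiteness of the sums above *)

Lemma finsupp_ubound (a : monomial) :
  exists N, forall i, i \in finsupp a -> (i < N)%N.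
Proof.
exists (\max_(i <- finsupp a) i).+1 => i ia.
by rewrite ltnS; apply: (leq_bigmax_seq (F := id)).
Qed.

Lemma finite_factorizations (a : monomial) :
  finite_set [set p : monomial * monomial | mmul p.1 p.2 = a].
Proof.
have [N aN] := finsupp_ubound a.
pose M := (\max_(i <- finsupp a) a i).+1.
have aM i : (a i < M)%N.
  have [ia|ia] := boolP (i \in finsupp a); last by rewrite fsfun_dflt.
  by rewrite ltnS; apply: (leq_bigmax_seq (F := a)).
pose b (g : {ffun 'I_N -> 'I_M}) : monomial :=
  mkcmonom [fsfun i in finsupp a => oapp (fun j => val (g j)) 0%N (insub i) | 0%N].
apply: (@sub_finite_set _ _ ((fun g => (b g, divcm a (b g))) @` setT)); last first.
  exact/finite_image/finite_finset.
move=> [x y] /= xy.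
have xya i : (x i + y i)%N = a i by rewrite -xy cmM.
have xM i : (x i < M)%N by apply: leq_ltn_trans (aM i); rewrite -xya leq_addr.
exists [ffun i => Ordinal (xM (val i))] => //.
have bE : b [ffun i => Ordinal (xM (val i))] = x.
  apply/eqP/cmP => i; rewrite cmE fsfunE.
  have [ia|ia] := boolP (i \in finsupp a).
    by rewrite (insubT (fun i => i < N)%N (aN i ia)) /= ffunE.
  by move: (xya i); rewrite (fsfun_dflt ia) => /eqP; rewrite addn_eq0 => /andP[/eqP].
by rewrite bE; congr pair; apply/eqP/cmP => i; rewrite divcmE -xya addKn.
Qed.

Lemma monom_prod_mem (I : eqType) (r : seq I) (f : I -> nat) (i : I) :
  i \in r -> f i \in finsupp (monom_prod r f).
Proof.
rewrite /monom_prod; elim: r => [//|j r IH]; rewrite big_cons mdomD in_fsetU inE.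
by case/predU1P => [->|/IH ->]; rewrite ?orbT // mdomU in_fset1 eqxx.
Qed.

Lemma finite_coloring_fiber (V : finType) (a : monomial) :
  finite_set [set k : {ffun V -> nat} | monom_prod (enum V) k = a].
Proof.
have [N aN] := finsupp_ubound a.
apply: (@sub_finite_set _ _
  ((fun g : {ffun V -> 'I_N} => [ffun x => val (g x)]) @` setT)); last first.
  exact/finite_image/finite_finset.
move=> k /= ka.
have kN x : (k x < N)%N by apply: aN; rewrite -ka monom_prod_mem // mem_enum.
by exists [ffun x => Ordinal (kN x)] => //; apply/ffunP => x; rewrite !ffunE.
Qed.

Lemma finite_tuple_fiber (n : nat) (a : monomial) :
  finite_set [set t : n.-tuple nat | monom_prod t id = a].
Proof.
have [N aN] := finsupp_ubound a.
apply: (@sub_finite_set _ _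
  ((fun g : {ffun 'I_n -> 'I_N} => [tuple val (g i) | i < n]) @` setT)); last first.
  exact/finite_image/finite_finset.
move=> t /= ta.
have tN i : (tnth t i < N)%N by apply: aN; rewrite -ta (monom_prod_mem id) // mem_tnth.
exists [ffun i => Ordinal (tN i)] => //.
by apply: eq_from_tnth => i; rewrite tnth_mktuple ffunE.
Qed.

(* Main.v *)
Require Import Defs.
From mathcomp Require Import all_boot all_order all_algebra.
From mathcomp Require Import finmap.
From mathcomp Require Import classical_sets fsbigop.
From mathcomp Require Import monalg.
From mathcomp Require Import ring zify.

(* Ordering the vertices of the graph along the cycle from [u] to [v] and then
   along the path exhibits a Hamiltonian path with two extra edges, both at its
   first vertex [u]. Write P_n, C_n and T_(m,l) for the chromatic symmetric
   functions of paths, cycles and tadpoles, n = m + l. Comparing the colors of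
   the ends of the extra edges gives
     X = 2 T_(m,l) - C_m P_l,   T_(m,l+1) + P_(m+l+1) = T_(m+1,l) + C_m P_(l+1),
   with T_(m,0) = C_m. Let E(z) be the generating function of the e_n. Transfer
   matrices give E C = z^2 E'' P and (E - z E') P = E, so that
     P_n = sum_I w_I e_I   and   C_n = sum_I (i_1 - 1) w_I e_I
   over the compositions I of n, where w_I = i_1 (i_2 - 1) (i_3 - 1) ... .
   Induction on l then shows that e_I has in T_(m,l) the coefficient
   (s - l - 1) w_I, with s the first partial sum of I exceeding l. In X it is
   2 (s - l - 1) w_I, minus (s - l) w_I = i_k w_I if l is the partial sum before
   the part i_k, and in this last case (i_k - 2) w_I >= 0 since k > 1 and
   w_I = 0 for i_k = 1.

   All this is done for polynomials in finitely many variables, with an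
   e-expansion that does not depend on their number. *)

Set Implicit Arguments. Unset Strict Implicit. Unset Printing Implicit Defensive.
Import Order.TTheory GRing.Theory Num.Theory.
Local Open Scope ring_scope.

(** * Colorings of paths, cycles and tadpoles *)

Section Walks.
Variables (R : comNzRingType) (K : finType) (x : K -> R).

(* [walk n] has [n] edges and [tail_sum n c] leaves out the factor [x c] of the
   first vertex; [path_sum], [cycle_sum] and the tadpoles count vertices. *)
Fixpoint walk (n : nat) (c d : K) : R :=
  if n is n'.+1 then x c * \sum_(b | b != c) walk n' b d else x c *+ (c == d).

Fixpoint tail_sum (l : nat) (c : K) : R :=
  if l is l'.+1 then \sum_(d | d != c) x d * tail_sum l' d else 1.

Lemma sumr_pred1 (I : finType) (F : I -> R) i (P : pred I) :
  \sum_(j | P j) F j *+ (j == i) = F i *+ P i.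
Proof.
rewrite big_mkcond (bigD1 i) //= eqxx mulr1n big1 ?addr0; first by case: (P i).
by move=> j /negbTE ->; rewrite mulr0n; case: ifP.
Qed.

(** [walk] peels off its first vertex by definition; peeling off the last one instead gives reversal
    of walks and allows gluing at the far end. *)
Lemma walkSr n c d : walk n.+1 c d = (\sum_(b | b != d) walk n c b) * x d.
Proof.
elim: n c d => [|n IH] c d.
  rewrite /= sumr_pred1; under eq_bigr => b _ do rewrite eq_sym.
  have -> : \sum_(b | b != d) x c *+ (b == c) = x c *+ (c != d).
    exact: (sumr_pred1 (fun=> x c)).
  by rewrite (eq_sym d); case: (c != d); rewrite ?mulr1n ?mulr0n ?mulr0 ?mul0r.
rewrite -[walk n.+2 c d]/(x c * \sum_(b | b != c) walk n.+1 b d).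
under eq_bigr => b _ do rewrite IH.
rewrite -mulr_suml mulrA; congr (_ * _).
by rewrite exchange_big mulr_sumr /=; apply: eq_bigr.
Qed.

Lemma walkC n c d : walk n c d = walk n d c.
Proof.
elim: n c d => [|n IH] c d; first by rewrite /= eq_sym; case: eqP => [->|].
by rewrite walkSr /= mulrC; congr (_ * _); apply: eq_bigr => b _.
Qed.

Lemma walk_sum n c : \sum_d walk n c d = x c * tail_sum n c.
Proof.
elim: n c => [|n IH] c /=.
  under eq_bigr => d _ do rewrite eq_sym.
  by rewrite (sumr_pred1 (fun=> x c)) mulr1.
rewrite -mulr_sumr exchange_big /=; congr (_ * _).
by apply: eq_bigr => b _; rewrite IH.
Qed.

Definition path_sum (n : nat) : R :=
  if n is n'.+1 then \sum_c x c * tail_sum n' c else 1.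

Definition cycle_sum (n : nat) : R :=
  if n is n'.+1 then \sum_c \sum_(d | d != c) walk n' c d else 0.

(** In both tadpole sums the cycle is cut open at one edge, its ends get the colors [c] and [e], and
    [e != c] restores the edge. In [line_tadpole_sum], [d] is the color of the path end joined to
    both. *)
Definition tadpole_sum (m l : nat) : R :=
  \sum_c \sum_(e | e != c) walk m.-1 c e * tail_sum l e.

Definition line_tadpole_sum (m l : nat) : R :=
  \sum_c \sum_(e | e != c) \sum_(d | (d != c) && (d != e))
    walk m.-1 c e * (x d * tail_sum l.-1 d).

Lemma tadpole_sum0 m : tadpole_sum m.+1 0 = cycle_sum m.+1.
Proof.
by apply: eq_bigr => c _; apply: eq_bigr => e _; rewrite mulr1.
Qed.

Lemma path_sum_split m l :
  path_sum (m + l).+1 = \sum_c \sum_e walk m c e * tail_sum l e.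
Proof.
elim: m l => [|m IH] l.
  rewrite /=; apply: eq_bigr => c _.
  under eq_bigr => e _ do rewrite mulrnAl eq_sym.
  by rewrite (sumr_pred1 (fun e => x c * tail_sum l e)).
rewrite addSnnS IH; apply: eq_bigr => c _ /=.
under eq_bigr => e _ do rewrite mulr_sumr big_mkcond.
rewrite exchange_big; apply: eq_bigr => d _ /=.
rewrite -/(walk m.+1 c d) walkSr -mulrA mulr_suml [RHS]big_mkcond /=.
by apply: eq_bigr => b _; rewrite eq_sym.
Qed.

Lemma sum3_mkcond (P1 : K -> K -> bool) (P2 : K -> K -> K -> bool)
    (F : K -> K -> K -> R) :
  \sum_c \sum_(e | P1 c e) \sum_(d | P2 c e d) F c e d =
  \sum_c \sum_e \sum_d F c e d *+ (P1 c e && P2 c e d).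
Proof.
apply: eq_bigr => c _; rewrite big_mkcond; apply: eq_bigr => e _ /=.
case: (P1 c e) => /=; last by rewrite big1.
by rewrite big_mkcond; apply: eq_bigr => d _; case: (P2 c e d).
Qed.


(** A common frame for all sums on [m + l + 2] vertices: a walk from [c] to [e], then a path
    starting at [d]. Linear relations between such sums become pointwise relations between the
    weights [B]. *)
Let wsum m l (B : K -> K -> K -> nat) :=
  \sum_c \sum_e \sum_d walk m c e * (x d * tail_sum l d) *+ B c e d.

Lemma wsumD m l A B : wsum m l A + wsum m l B =
  wsum m l (fun c e d => (A c e d + B c e d)%N).
Proof.
rewrite -big_split; apply: eq_bigr => c _; rewrite -big_split.
apply: eq_bigr => e _; rewrite -big_split; apply: eq_bigr => d _.
by rewrite /= mulrnDr.
Qed.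

Lemma eq_wsum m l A B : (forall c e d, A c e d = B c e d) ->
  wsum m l A = wsum m l B.
Proof.
by move=> AB; apply: eq_bigr => c _; apply: eq_bigr => e _;
  apply: eq_bigr => d _; rewrite AB.
Qed.

Lemma tadpole_sumE1 m l :
  tadpole_sum m.+1 l.+1 = wsum m l (fun c e d => (e != c) && (d != e)).
Proof.
rewrite /wsum -(sum3_mkcond (fun c e => e != c) (fun c e d => d != e)).
by apply: eq_bigr => c _; apply: eq_bigr => e _; rewrite mulr_sumr.
Qed.

(** Here [d] colors the last vertex of the cycle, whereas in [tadpole_sumE1] it colors the first
    vertex of the tail. *)
Lemma tadpole_sumE2 m l :
  tadpole_sum m.+2 l = wsum m l (fun c e d => (d != c) && (d != e)).
Proof.
apply: eq_bigr => c _; rewrite exchange_big /= [LHS]big_mkcond.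
apply: eq_bigr => d _; rewrite -/(walk m.+1 c d) walkSr.
case: (d != c) => /=; last by rewrite big1.
rewrite -mulrA mulr_suml big_mkcond; apply: eq_bigr => e _.
by rewrite eq_sym; case: (d != e).
Qed.

Lemma path_sumE m l : path_sum (m + l).+2 = wsum m l (fun c e d => d != e).
Proof.
rewrite -addnS path_sum_split; apply: eq_bigr => c _; apply: eq_bigr => e _.
rewrite mulr_sumr big_mkcond; apply: eq_bigr => d _.
by case: (d != e).
Qed.

Lemma cycle_path_sumE m l :
  cycle_sum m.+1 * path_sum l.+1 = wsum m l (fun c e d => e != c).
Proof.
rewrite mulr_suml; apply: eq_bigr => c _.
rewrite mulr_suml big_mkcond; apply: eq_bigr => e _.
by case: (e != c); rewrite ?mulr_sumr // big1.
Qed.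

(* Traversing the walk backwards. *)
Lemma wsum_swap m l : wsum m l (fun c e d => (d == c) && (e != d)) =
  wsum m l (fun c e d => (d == e) && (e != c)).
Proof.
rewrite [RHS]exchange_big; apply: eq_bigr => c _; apply: eq_bigr => e _ /=.
apply: eq_bigr => d _; rewrite walkC.
by case: (eqVneq d c) => //= ->; rewrite eq_sym.
Qed.

Lemma tadpole_sum_rec m l :
  tadpole_sum m.+1 l.+1 + path_sum (m + l).+2 =
  tadpole_sum m.+2 l + cycle_sum m.+1 * path_sum l.+1.
Proof.
rewrite tadpole_sumE1 tadpole_sumE2 path_sumE cycle_path_sumE.
(* The weights agree only up to two terms, which have equal sums by reversing the walk; with these
   added, both sides have weight [(e != c) + (d != e)]. *)
apply: (addIr (wsum m l (fun c e d => (d == e) && (e != c)))).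
rewrite -[in RHS]wsum_swap !wsumD; apply: eq_wsum => c e d.
have [dc|dc] := eqVneq d c; have [ec|ec] := eqVneq e c; subst; rewrite ?eqxx //;
  by case: eqVneq.
Qed.

(** When [d != e], at most one of [d] and [e] equals [c], so that [(e != c) && (d != c)] plus 1 is
    [(e != c) + (d != c)]. *)
Lemma line_tadpole_sumE m l : line_tadpole_sum m.+1 l.+1 + path_sum (m + l).+2 =
  tadpole_sum m.+1 l.+1 + tadpole_sum m.+2 l.
Proof.
rewrite tadpole_sumE1 tadpole_sumE2 path_sumE.
rewrite /line_tadpole_sum (sum3_mkcond (fun c e => e != c)
  (fun c e d => (d != c) && (d != e))) -/(wsum m l _).
rewrite !wsumD; apply: eq_wsum => c e d.
have [dc|dc] := eqVneq d c; have [ec|ec] := eqVneq e c; subst; rewrite ?eqxx //;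
  by case: eqVneq.
Qed.
End Walks.

(** * Generating functions *)

Lemma deriv_prod (R : comNzRingType) (I : finType) (A : pred I) (F : I -> {poly R}) :
  (\prod_(i | A i) F i)^`() =
  \sum_(i | A i) (F i)^`() * \prod_(j | A j && (j != i)) F j.
Proof.
rewrite -big_filter -[RHS]big_filter.
under [RHS]eq_bigr => i _ do rewrite -big_filter_cond.
have: uniq [seq i <- index_enum I | A i] by rewrite filter_uniq // index_enum_uniq.
elim: [seq _ <- _ | _] => [|i r IH] /=; first by rewrite !big_nil derivC.
case/andP => ir /IH {}IH; rewrite !big_cons eqxx /= derivM IH.
congr (_ * _ + _).
  rewrite [RHS]big_seq_cond [LHS]big_seq_cond; apply: eq_bigl => j.
  by rewrite andbT; case: eqP => [->|]; rewrite ?(negbTE ir) ?andbT.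
rewrite mulr_sumr big_seq_cond [RHS]big_seq_cond; apply: eq_bigr => j /andP[jr _].
rewrite big_cons ifT; first by rewrite mulrCA.
by apply: contraNneq ir => ->.
Qed.

(** * Polynomials modulo a power of the variable, in place of power series *)

Section EqModX.
Variables (R : comNzRingType) (k : nat).
Implicit Types p q r : {poly R}.

Definition eqmodX p q := exists r, p = q + r * 'X^k.

Lemma eqmodX_refl p : eqmodX p p.
Proof. by exists 0; rewrite mul0r addr0. Qed.

Lemma eqmodX_sym p q : eqmodX p q -> eqmodX q p.
Proof. by case=> r ->; exists (- r); ring. Qed.

Lemma eqmodX_trans q p r : eqmodX p q -> eqmodX q r -> eqmodX p r.
Proof. by case=> s -> [t ->]; exists (t + s); ring. Qed.

Lemma eqmodXD p q p' q' : eqmodX p q -> eqmodX p' q' -> eqmodX (p + p') (q + q').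
Proof. by case=> s -> [t ->]; exists (s + t); ring. Qed.

Lemma eqmodXMl r p q : eqmodX p q -> eqmodX (r * p) (r * q).
Proof. by case=> s ->; exists (r * s); ring. Qed.

Lemma eqmodXMr r p q : eqmodX p q -> eqmodX (p * r) (q * r).
Proof. by case=> s ->; exists (r * s); ring. Qed.

Lemma eqmodX_sum (I : finType) (P : pred I) (F G : I -> {poly R}) :
  (forall i, P i -> eqmodX (F i) (G i)) ->
  eqmodX (\sum_(i | P i) F i) (\sum_(i | P i) G i).
Proof.
move=> FG; elim/big_ind2: _ => //; first exact: eqmodX_refl.
by move=> *; apply: eqmodXD.
Qed.

Lemma eqmodX_coef p q n : eqmodX p q -> (n < k)%N -> p`_n = q`_n.
Proof. by case=> r -> nk; rewrite coefD coefMXn nk addr0. Qed.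

Lemma coef_eqmodX p q : (forall n, (n < k)%N -> p`_n = q`_n) -> eqmodX p q.
Proof.
move=> pq; exists (drop_poly k (p - q)).
have tpq : take_poly k (p - q) = 0.
  by apply/polyP => i; rewrite coef_take_poly coefB coef0; case: ifP => // /pq ->; ring.
by rewrite -[LHS](subrK q) addrC -{1}(poly_take_drop k (p - q)) tpq add0r.
Qed.

(** The variable divides [p], so [p ^+ k] vanishes modulo ['X^k] and the geometric sum
    telescopes. *)
Lemma eqmodX_geom p : p`_0 = 0 -> eqmodX ((1 - p) * \sum_(j < k) p ^+ j) 1.
Proof.
move=> p0; have tp : take_poly 1 p = 0.
  by apply/polyP => -[|i]; rewrite coef_take_poly coef0.
have -> : p = drop_poly 1 p * 'X.
  by rewrite -{1}(poly_take_drop 1 p) tp expr1 add0r.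
set q := drop_poly 1 p; exists (- q ^+ k).
have := subrX1 (q * 'X) k; rewrite exprMn => H.
by rewrite mulNr -(opprK (1 - _)) opprB mulNr -H; ring.
Qed.

Lemma eqmodX_cancel p q r : p`_0 = 1 -> eqmodX (p * q) (p * r) -> eqmodX q r.
Proof.
move=> p0 pqr; have/eqmodX_geom : (1 - p)`_0 = 0 by rewrite coefB coef1 p0 subrr.
set s := \sum_(_ < _) _; rewrite opprB addrC subrK => ps.
apply: eqmodX_trans (_ : eqmodX (p * s * q) _).
  by rewrite -[X in eqmodX X]mul1r; apply/eqmodXMr/eqmodX_sym.
apply: eqmodX_trans (_ : eqmodX (p * s * r) _); last first.
  by rewrite -[X in eqmodX _ X]mul1r; apply/eqmodXMr.
by rewrite ![p * s]mulrC -!mulrA; apply: eqmodXMl.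
Qed.
End EqModX.

Section GeneratingFunctions.
Variables (R : comNzRingType) (K : finType) (x : K -> R) (k : nat).

Definition elem_poly : {poly R} := \prod_c (1 + (x c)%:P * 'X).
Let E := elem_poly.
Let E1 c := \prod_(d | d != c) (1 + (x d)%:P * 'X).
Let E2 c d := \prod_(b | (b != c) && (b != d)) (1 + (x b)%:P * 'X).

Lemma elem_poly0 : E`_0 = 1.
Proof.
rewrite -horner_coef0 horner_prod big1 // => c _.
by rewrite !hornerE ?mulr0 ?addr0.
Qed.

Let deriv_factor c : (1 + (x c)%:P * 'X)^`() = (x c)%:P :> {poly R}.
Proof. by rewrite derivD derivC deriv_mulC derivX; ring. Qed.

Let deriv1E : E^`() = \sum_c (x c)%:P * E1 c.
Proof.
by rewrite /E deriv_prod; apply: eq_bigr => c _; rewrite deriv_factor.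
Qed.

Let deriv2E : E^`()^`() = \sum_c \sum_(d | d != c) (x c)%:P * (x d)%:P * E2 c d.
Proof.
rewrite deriv1E raddf_sum; apply: eq_bigr => c _ /=.
rewrite deriv_mulC deriv_prod mulr_sumr; apply: eq_bigr => d _.
by rewrite deriv_factor mulrA.
Qed.

(** Truncated generating functions; the extra factor ['X] in [P] and [C] makes the degree count
    vertices. *)
Let U c := \poly_(i < k) tail_sum x i c.
Let W c d := \poly_(i < k) walk x i c d.
Let P := 1 + \sum_c (x c)%:P * 'X * U c.
Let C := \sum_c \sum_(d | d != c) 'X * W c d.

Let coefP n : (n <= k)%N -> P`_n = path_sum x n.
Proof.
rewrite coefD coef1 coef_sum; case: n => [|n] nk /=.
  by rewrite big1 ?addr0 // => c _; rewrite -mulrA coefCM coefXM mulr0.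
rewrite add0r; apply: eq_bigr => c _.
by rewrite -mulrA coefCM coefXM coef_poly nk.
Qed.

Let coefC n : (n <= k)%N -> C`_n = cycle_sum x n.
Proof.
rewrite coef_sum; case: n => [|n] nk /=.
  by rewrite big1 // => c _; rewrite coef_sum big1 // => d _; rewrite coefXM.
apply: eq_bigr => c _; rewrite coef_sum; apply: eq_bigr => d _.
by rewrite coefXM coef_poly nk.
Qed.

(** Multiplying by [1 + x_c z] adds back the term [d = c] that [tail_sum] leaves out, which
    completes the sum to a path sum. *)
Let U_rec c : eqmodX k ((1 + (x c)%:P * 'X) * U c) P.
Proof.
apply: coef_eqmodX => n nk; rewrite coefP ?(ltnW nk) //.
rewrite mulrDl mul1r coefD -mulrA coefCM coefXM !coef_poly nk.
case: n nk => [|n] nk /=; first by rewrite mulr0 addr0.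
by rewrite (ltnW nk) [RHS](bigD1 c) //= addrC.
Qed.

(** By [walkSr] and [walk_sum]: the factor adds back the walks whose last but one vertex also has
    color [d]. The constant term vanishes because [d != c]. *)
Let W_rec c d : d != c ->
  eqmodX k ((1 + (x d)%:P * 'X) * W c d) ((x c)%:P * (x d)%:P * 'X * U c).
Proof.
move=> dc; apply: coef_eqmodX => n nk.
rewrite mulrDl mul1r coefD -!mulrA !coefCM !coefXM !coef_poly nk.
case: n nk => [|n] nk /=.
  by rewrite eq_sym (negbTE dc) !mulr0 addr0.
rewrite (ltnW nk) -/(walk x n.+1 c d) walkSr.
by rewrite [RHS]mulrCA -walk_sum [in RHS](bigD1 d) //=; ring.
Qed.

Lemma path_elem_poly : eqmodX k (E * P) (E + 'X * E^`() * P).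
Proof.
rewrite {1}/P mulrDr mulr1; apply: eqmodXD; first exact: eqmodX_refl.
rewrite deriv1E !(mulr_sumr, mulr_suml); apply: eqmodX_sum => c _.
have -> : E * ((x c)%:P * 'X * U c) =
    (x c)%:P * 'X * E1 c * ((1 + (x c)%:P * 'X) * U c).
  by rewrite /E /elem_poly (bigD1 c) //= -/(E1 c); ring.
have -> : 'X * ((x c)%:P * E1 c) * P = (x c)%:P * 'X * E1 c * P by ring.
exact: eqmodXMl.
Qed.

(** For each pair of end colors, the two factors of [E] missing in [E2 c d] are absorbed by [W_rec]
    and [U_rec]; the sum of [x_c x_d E2 c d] is the second derivative. *)
Lemma cycle_elem_poly : eqmodX k (E * C) ('X ^+ 2 * E^`()^`() * P).
Proof.
rewrite deriv2E /C !(mulr_sumr, mulr_suml); apply: eqmodX_sum => c _.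
rewrite !(mulr_sumr, mulr_suml); apply: eqmodX_sum => d dc.
apply: eqmodX_trans (_ : eqmodX k ('X * E2 c d * (1 + (x c)%:P * 'X) *
   ((x c)%:P * (x d)%:P * 'X * U c)) _).
  have -> : E * ('X * W c d) =
    'X * E2 c d * (1 + (x c)%:P * 'X) * ((1 + (x d)%:P * 'X) * W c d).
    rewrite /E /elem_poly (bigD1 c) //= (bigD1 d) //= -/(E2 c d); ring.
  exact/eqmodXMl/W_rec.
have -> : 'X * E2 c d * (1 + (x c)%:P * 'X) * ((x c)%:P * (x d)%:P * 'X * U c) =
  'X ^+ 2 * ((x c)%:P * (x d)%:P * E2 c d) * ((1 + (x c)%:P * 'X) * U c) by ring.
exact: eqmodXMl.
Qed.

(* [composition_gf] expands [1 / (E - z E')] up to order [k]: its coefficient of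
   [z^n] is the sum of (i_1 - 1) ... (i_r - 1) e_I over the compositions I of n. *)
Definition composition_base : {poly R} := 1 - (E - 'X * E^`()).
Definition composition_gf : {poly R} := \sum_(j < k) composition_base ^+ j.
Let H := composition_gf.
Let e := nth 0 E.

Lemma coef_composition_base n : composition_base`_n = e n *+ n.-1.
Proof.
rewrite !coefB coef1 coefXM /e; case: n => [|n] /=.
  by rewrite elem_poly0 subr0 subrr.
by rewrite coef_deriv mulrSr; ring.
Qed.

Let FH : eqmodX k ((E - 'X * E^`()) * H) 1.
Proof.
have -> : E - 'X * E^`() = 1 - composition_base by rewrite /composition_base; ring.
by apply: eqmodX_geom; rewrite coef_composition_base mulr0n.
Qed.

Let FP : eqmodX k ((E - 'X * E^`()) * P) E.
Proof.
rewrite mulrBl -[X in eqmodX k _ X](addrK ('X * E^`() * P)).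
exact/eqmodXD/eqmodX_refl/path_elem_poly.
Qed.

Let PEH : eqmodX k P (E * H).
Proof.
apply: eqmodX_trans (_ : eqmodX k (P * ((E - 'X * E^`()) * H)) _).
  by rewrite -[X in eqmodX _ X]mulr1; apply/eqmodXMl/eqmodX_sym.
by rewrite mulrA; apply: eqmodXMr; rewrite mulrC.
Qed.

Lemma composition_gf_rec n : (n.+1 < k)%N ->
  H`_n.+1 = \sum_(j < n.+1) e j.+1 *+ j * H`_(n - j).
Proof.
move=> nk; have HE : eqmodX k H (1 + composition_base * H).
  have -> : 1 + composition_base * H = H + (1 - (E - 'X * E^`()) * H).
    by rewrite /composition_base; ring.
  rewrite -[X in eqmodX _ X]addr0; apply: eqmodXD; first exact: eqmodX_refl.
  rewrite -[X in eqmodX _ X](subrr 1); apply: eqmodXD; first exact: eqmodX_refl.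
  by have := eqmodXMl (-1) (eqmodX_sym FH); rewrite !mulN1r.
rewrite (eqmodX_coef HE nk) coefD coef1 add0r coefM big_ord_recl.
rewrite coef_composition_base /= mul0r add0r; apply: eq_bigr => j _.
by rewrite coef_composition_base subSS.
Qed.

(** From [P = E H] and [(E - z E') H = 1] one gets [P = 1 + z E' H]; the index [j.+1] is the first
    part. *)
Lemma path_sum_composition n : (n.+1 < k)%N ->
  path_sum x n.+1 = \sum_(j < n.+1) e j.+1 *+ j.+1 * H`_(n - j).
Proof.
move=> nk; rewrite -coefP ?(ltnW nk) //.
have PE : eqmodX k P (1 + 'X * E^`() * H).
  apply: eqmodX_trans PEH _.
  rewrite -[X in eqmodX _ X](subrK ('X * E^`() * H)) -mulrBl.
  exact/eqmodXD/eqmodX_refl/FH.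
rewrite (eqmodX_coef PE nk) coefD coef1 add0r -mulrA coefXM coefM.
by apply: eq_bigr => j _; rewrite coef_deriv.
Qed.

(** The same compositions with the last part split off, from [P = E + P * composition_base]; this is
    the form in which [crossing_sum] grows. *)
Lemma path_sum_rec n : (n.+1 < k)%N -> path_sum x n.+1 = e n.+1 *+ n.+1 +
  \sum_(j < n) path_sum x j.+1 * (e (n - j) *+ (n - j).-1).
Proof.
move=> nk; rewrite -coefP ?(ltnW nk) //.
have PE : eqmodX k P (E + P * composition_base).
  rewrite -[X in eqmodX _ X](subrK (P * composition_base)).
  apply/eqmodXD/eqmodX_refl; have -> : P - P * composition_base = (E - 'X * E^`()) * P.
    by rewrite /composition_base; ring.
  exact: FP.
rewrite (eqmodX_coef PE nk) coefD coefM big_ord_recl big_ord_recr /=.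
rewrite subnn subn0 !coef_composition_base /= mulr0n mulr0 addr0.
rewrite coefP // /= mul1r addrA -/(e _) -mulrS; congr (_ + _).
apply: eq_bigr => j _.
rewrite coefP ?coef_composition_base // (leq_trans (ltn_ord j)) //; exact/ltnW/ltnW.
Qed.

Lemma cycle_sum_composition n : (n.+1 < k)%N ->
  cycle_sum x n.+1 = \sum_(j < n.+1) e j.+1 *+ (j.+1 * j) * H`_(n - j).
Proof.
move=> nk; rewrite -coefC ?(ltnW nk) //.
have CE : eqmodX k C ('X ^+ 2 * E^`()^`() * H).
  apply: (@eqmodX_cancel _ _ E); first exact: elem_poly0.
  apply: eqmodX_trans cycle_elem_poly _.
  by rewrite mulrCA; apply/eqmodXMl/PEH.
rewrite (eqmodX_coef CE nk) -!mulrA coefXM /= coefXM.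
case: n nk => [|n] nk /=.
  by rewrite big_ord1 /= muln0 mulr0n mul0r.
rewrite coefM [RHS]big_ord_recl /= muln0 mulr0n mul0r add0r.
apply: eq_bigr => j _; rewrite !coef_deriv -mulrnA subSS; congr (_ *+ _ * _).
Qed.

End GeneratingFunctions.

(** * Compositions crossing a given partial sum *)

Local Arguments path_sum : simpl never.
Local Arguments cycle_sum : simpl never.

Section Positivity.
Variables (R : comNzRingType) (K : finType) (x : K -> R).
Let e := nth 0 (elem_poly x).
Let P := path_sum x.

(* The sum of i_1 (i_2 - 1) ... (i_r - 1) e_I over the compositions I of
   [l + 1 + j] with i_1 + ... + i_(r-1) <= l. *)
Fixpoint crossing_sum (l j : nat) : R :=
  if l is l'.+1 then crossing_sum l' j.+1 + P l * (e j.+1 *+ j)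
  else e j.+1 *+ j.+1.

Lemma crossing_sumE l j : crossing_sum l j = e (l + j).+1 *+ (l + j).+1 +
  \sum_(b < l) P b.+1 * (e (l + j - b) *+ (l + j - b).-1).
Proof.
elim: l j => [|l IH] j /=; first by rewrite big_ord0 addr0.
rewrite IH big_ord_recr /= -!addSnnS addrA; congr (_ + _ + _ * (e _ *+ _)); lia.
Qed.

Variable k : nat.
Let H := nth 0 (composition_gf x k).

(** All compositions of [l + 1] qualify: a proper partial sum is at most [l]. *)
Lemma crossing_sum0 l : (l.+1 < k)%N -> crossing_sum l 0 = P l.+1.
Proof. by move=> lk; rewrite crossing_sumE addn0 /P (path_sum_rec _ lk). Qed.

(** Each composition is cut at its first partial sum exceeding [l], namely [l + 1 + j]; the
    remaining parts form a composition of [m - j], weighted as in [H]. *)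
Lemma path_sum_crossing m l : ((m + l).+1 < k)%N ->
  P (m + l).+1 = \sum_(j < m.+1) crossing_sum l j * H (m - j).
Proof.
elim: l m => [|l IH] m mlk; first by rewrite addn0 in mlk *; exact: path_sum_composition.
under eq_bigr => j _ do rewrite /= mulrDl -mulrA.
rewrite big_split /= -mulr_sumr -composition_gf_rec; last by lia.
rewrite -addSnnS IH ?addSnnS // big_ord_recl addrC /= crossing_sum0; last by lia.
by congr (_ + _); apply: eq_bigr => j _; rewrite subSS.
Qed.

Lemma tadpole_sum_crossing m l : ((m + l).+1 < k)%N ->
  tadpole_sum x m.+1 l = \sum_(j < m.+1) crossing_sum l j *+ j * H (m - j).
Proof.
elim: l m => [|l IH] m mlk.
  rewrite tadpole_sum0 (@cycle_sum_composition _ _ x k) //; last by lia.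
  by apply: eq_bigr => j _; rewrite -mulrnA.
apply: (addIr (P (m + l).+2)); rewrite tadpole_sum_rec IH; last by lia.
rewrite -[(m + l).+1]addSn (path_sum_crossing (m := m.+1)); last by lia.
(* The term [j = 0] vanishes in the tadpole sum and is [P l.+1 * H m.+1] in the path sum. Expanding
   [H m.+1] by its first part lets the identity be checked term by term. *)
rewrite [in LHS]big_ord_recl [in RHS](big_ord_recl m.+1 (fun j => crossing_sum l j * _)).
rewrite /= mulr0n mul0r add0r crossing_sum0; last by lia.
have Hrec : H m.+1 = \sum_(j < m.+1) e j.+1 *+ j * H (m - j).
  by apply: composition_gf_rec; lia.
rewrite subn0 Hrec (@cycle_sum_composition _ _ x k m); last by lia.
rewrite [_ * path_sum _ _]mulrC -/(P _) !mulr_sumr -!big_split /=; apply: eq_bigr => j _.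
rewrite /bump /= add1n subSS -/(H _) -/(e _); ring.
Qed.

(** The first sum collects the compositions without partial sum [l + 1], the second those with it.
    In the latter, twice the tadpole gives [2 j * j] and the product of cycle and path takes away
    [(j + 1) j], which leaves [j (j - 1)]. *)
Lemma line_tadpole_sum_crossing m l : ((m + l).+2 < k)%N ->
  line_tadpole_sum x m.+1 l.+1 =
    \sum_(j < m.+1) crossing_sum l j.+1 *+ (2 * j) * H (m - j) +
    P l.+1 * \sum_(j < m.+1) e j.+1 *+ (j * j.-1) * H (m - j).
Proof.
move=> mlk; set X := line_tadpole_sum _ _ _; set T := tadpole_sum x m.+1 l.+1.
have X2T : X + P l.+1 * cycle_sum x m.+1 = T + T.
  apply: (addIr (P (m + l).+2)); rewrite addrAC line_tadpole_sumE mulrC.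
  by rewrite -!addrA tadpole_sum_rec.
apply: (addIr (P l.+1 * cycle_sum x m.+1)); rewrite X2T.
rewrite /T tadpole_sum_crossing ?(@cycle_sum_composition _ _ x k m); try lia.
rewrite !mulr_sumr -!big_split /=; apply: eq_bigr => j _.
case: j => -[|j] jm /=; rewrite -/(e _) -/(H _) -/(P _); ring.
Qed.
End Positivity.

(** * Colorings of the line graph *)

Section Colorings.
Variables (R : comNzRingType) (K : finType) (x : K -> R).

Definition properb (V : finType) (adj : rel V) (k : {ffun V -> K}) : bool :=
  [forall v, forall w, adj v w ==> (k v != k w)].

Definition chromatic_sum (V : finType) (adj : rel V) : R :=
  \sum_(k : {ffun V -> K} | properb adj k) \prod_v x (k v).

Lemma properbP (V : finType) (adj : rel V) (k : {ffun V -> K}) :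
  reflect (forall v w, adj v w -> k v != k w) (properb adj k).
Proof.
by apply: (iffP 'forall_forallP) => h v w; apply/implyP; apply: h.
Qed.

Lemma chromatic_sum_iso (V V' : finType) (adj : rel V) (adj' : rel V') (f : V -> V') :
  bijective f -> (forall v w, adj' (f v) (f w) = adj v w) ->
  chromatic_sum adj = chromatic_sum adj'.
Proof.
move=> [g fK gK] f_adj; rewrite /chromatic_sum.
pose h (k : {ffun V' -> K}) := [ffun v => k (f v)].
pose h' (k : {ffun V -> K}) := [ffun v => k (g v)].
have hK : cancel h h' by move=> k; apply/ffunP => v; rewrite !ffunE gK.
have h'K : cancel h' h by move=> k; apply/ffunP => v; rewrite !ffunE fK.
rewrite (reindex h) /=; last by apply: onW_bij; exists h'.
apply: eq_big => [k|k _].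
  apply/properbP/properbP => kP v w.
    by move=> vw; have := kP (g v) (g w); rewrite -f_adj !ffunE !gK; apply.
  by rewrite !ffunE -f_adj => /kP.
rewrite [RHS](reindex f) /=; last by apply: onW_bij; exists g.
by apply: eq_bigr => v _; rewrite ffunE.
Qed.

Lemma big_tuple_nil (F : seq K -> R) : \sum_(t : 0.-tuple K) F t = F [::].
Proof. by rewrite (big_pred1 [tuple]) // => t; rewrite [t]tuple0; apply/eqP. Qed.

Lemma big_tuple_cons n (F : n.+1.-tuple K -> R) :
  \sum_(t : n.+1.-tuple K) F t = \sum_c \sum_(t : n.-tuple K) F [tuple of c :: t].
Proof.
rewrite pair_big /= (reindex (fun p : K * n.-tuple K => [tuple of p.1 :: p.2])) //=.
apply: onW_bij; exists (fun t : n.+1.-tuple K => (thead t, [tuple of behead t])).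
  by case=> c t; rewrite /= theadE; congr (_, _); apply: val_inj.
by move=> t; rewrite [RHS]tuple_eta; apply: val_inj.
Qed.

Let neq : rel K := fun c d => c != d.

(** The weight [G] stands for whatever part of the graph is attached to the last vertex of the
    walk. *)
Lemma walk_tuple n c (G : K -> R) :
  \sum_(t : n.-tuple K | path neq c t) x c * (\prod_(d <- t) x d) * G (last c t) =
  \sum_d walk x n c d * G d.
Proof.
rewrite big_mkcond /=; elim: n c => [|n IH] c.
  rewrite (big_tuple_nil (fun t => if path neq c t then
    x c * (\prod_(d <- t) x d) * G (last c t) else 0)) /= big_nil mulr1.
  under eq_bigr => d _ do rewrite mulrnAl eq_sym.
  by rewrite (sumr_pred1 (fun d => x c * G d)).
rewrite (big_tuple_cons (fun t : n.+1.-tuple K => if path neq c t then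
  x c * (\prod_(d <- t) x d) * G (last c t) else 0)) /=.
under [RHS]eq_bigr => d _ do rewrite -mulrA mulr_suml.
rewrite -mulr_sumr [in RHS]exchange_big mulr_sumr [RHS]big_mkcond /=.
apply: eq_bigr => b _ /=.
rewrite -IH mulr_sumr /neq eq_sym; case: (b != c) => /=; last by rewrite big1.
by apply: eq_bigr => t _; case: ifP => _; rewrite ?mulr0 // big_cons !mulrA.
Qed.

Lemma tail_sum_tuple n c :
  \sum_(t : n.-tuple K | path neq c t) \prod_(d <- t) x d = tail_sum x n c.
Proof.
rewrite big_mkcond /=; elim: n c => [|n IH] c /=.
  by rewrite (big_tuple_nil (fun t => if path neq c t then
    \prod_(d <- t) x d else 0)) /= big_nil.
rewrite (big_tuple_cons (fun t : n.+1.-tuple K => if path neq c t then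
  \prod_(d <- t) x d else 0)) /=.
rewrite [RHS]big_mkcond; apply: eq_bigr => b _ /=.
rewrite -IH mulr_sumr /neq eq_sym; case: (b != c) => /=; last by rewrite big1.
by apply: eq_bigr => t _; case: ifP => _; rewrite ?mulr0 // big_cons.
Qed.

Let glue m l (p : m.-tuple K * l.-tuple K) : {ffun 'I_m + 'I_l -> K} :=
  [ffun v => match v with inl i => tnth p.1 i | inr j => tnth p.2 j end].

Let glue_bij m l : bijective (@glue m l).
Proof.
exists (fun k : {ffun 'I_m + 'I_l -> K} =>
  ([tuple k (inl i) | i < m], [tuple k (inr j) | j < l])).
  move=> [s t]; congr pair; apply: eq_from_tnth => i.
    by rewrite tnth_mktuple ffunE.
  by rewrite tnth_mktuple ffunE.
by move=> k; apply/ffunP => -[i|j]; rewrite ffunE tnth_mktuple.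
Qed.

(** The conditions are, in order, the cycle cut open, the path, the closing edge of the cycle, and
    the two edges joining cycle and path. *)
Lemma properb_glue m l (c d : K) (s : m.-tuple K) (t : l.-tuple K) :
  properb (line_tadpole_adj ord0 ord_max ord0)
    (glue ([tuple of c :: s], [tuple of d :: t])) =
  [&& path neq c s, path neq d t, last c s != c, d != c & d != last c s].
Proof.
have tnE n (a : K) (r : n.-tuple K) (i : 'I_n.+1) :
  tnth [tuple of a :: r] i = nth c (a :: r) i by exact: tnth_nth.
have lastE : tnth [tuple of c :: s] ord_max = last c s.
  by rewrite tnE /= (last_nth c) size_tuple.
have consE n (a : K) (r : n.-tuple K) : path neq a r = sorted neq (a :: r) by [].
apply/properbP/and5P => [kP|[]].
  have headE : c != last c s.
    have := kP (inl ord_max) (inl ord0).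
    rewrite !ffunE /= lastE eq_sym; apply.
    by apply/orP; left; apply/eqP/val_inj; rewrite /= modnn.
  split; rewrite 1?eq_sym //.
  - rewrite consE; apply/(sortedP c) => i; rewrite /= ltnS size_tuple => im.
    have := kP (inl (inord i)) (inl (inord i.+1)).
    rewrite !ffunE !tnE !inordK //; last exact: ltnW.
    apply; apply/orP; left; apply/eqP/val_inj.
    by rewrite /= !inordK ?modn_small // ltnS ltnW.
  - rewrite consE; apply/(sortedP c) => i; rewrite /= ltnS size_tuple => im.
    have := kP (inr (inord i)) (inr (inord i.+1)).
    rewrite !ffunE !tnE !inordK //; last exact: ltnW.
    by apply; apply/orP; left; rewrite !inordK // ltnW.
  - have := kP (inl ord0) (inr ord0); rewrite !ffunE /= eqxx; exact.
  - by have := kP (inl ord_max) (inr ord0); rewrite !ffunE /= lastE eqxx orbT eq_sym; apply.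
rewrite !consE => /(sortedP c) sP /(sortedP c) tP lc dc dl.
have sS i j : j = ordS i -> tnth [tuple of c :: s] i != tnth [tuple of c :: s] j.
  move=> ->; rewrite !tnE; have := ltn_ord i; rewrite leq_eqVlt => /orP[/eqP im|im].
    rewrite /= im modnn /=; have -> : i = ord_max by apply: val_inj; case: im.
    by move: lc; rewrite -lastE tnE.
  by rewrite /= modn_small //; apply: sP; rewrite /= size_tuple.
have tS (i j : 'I_l.+1) : j = i.+1 :> nat ->
    tnth [tuple of d :: t] i != tnth [tuple of d :: t] j.
  by move=> ij; rewrite !tnE ij; apply: tP; rewrite /= size_tuple -ij.
have st (i : 'I_m.+1) (j : 'I_l.+1) : ((i == ord0) || (i == ord_max)) && (j == ord0) ->
    tnth [tuple of d :: t] j != tnth [tuple of c :: s] i.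
  by case/andP => /orP[] /eqP -> /eqP ->; rewrite ?lastE.
move=> [i|i] [j|j]; rewrite !ffunE /=.
- by case/orP => /eqP ij; last rewrite eq_sym; apply: sS.
- by move/st; rewrite eq_sym.
- exact: st.
- by case/orP => /eqP ij; last rewrite eq_sym; apply: tS.
Qed.

Lemma chromatic_line_tadpole m l :
  chromatic_sum (@line_tadpole_adj m.+1 l.+1 ord0 ord_max ord0) =
  line_tadpole_sum x m.+1 l.+1.
Proof.
rewrite /chromatic_sum (reindex (@glue m.+1 l.+1)); last exact/onW_bij/glue_bij.
transitivity (\sum_(s : m.+1.-tuple K) \sum_(t : l.+1.-tuple K)
    if properb (line_tadpole_adj ord0 ord_max ord0) (glue (s, t)) then
    (\prod_(c <- s) x c) * \prod_(d <- t) x d else 0).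
  rewrite pair_big big_mkcond /=; apply: eq_bigr => -[s t] _ /=; case: ifP => // _.
  rewrite big_sumType !big_tuple /=; congr (_ * _); apply: eq_bigr => i _.
    by rewrite ffunE.
  by rewrite ffunE.
rewrite big_tuple_cons; apply: eq_bigr => c _.
rewrite [RHS]big_mkcond /=.
(* For fixed [c], everything beyond the walk is a function of its last color [e], as [walk_tuple]
   requires. *)
transitivity (\sum_e walk x m c e * if e != c then
    \sum_(d | (d != c) && (d != e)) x d * tail_sum x l d else 0); last first.
  by apply: eq_bigr => e _; case: ifP => _; rewrite ?mulr0 // mulr_sumr.
rewrite -walk_tuple [RHS]big_mkcond; apply: eq_bigr => s _.
transitivity (\sum_d \sum_(t : l.-tuple K)
    if [&& path neq c s, path neq d t, last c s != c, d != c & d != last c s] then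
    (x c * \prod_(b <- s) x b) * (x d * \prod_(b <- t) x b) else 0).
  rewrite big_tuple_cons; apply: eq_bigr => d _.
  by apply: eq_bigr => t _; rewrite properb_glue !big_cons.
case: (path neq c s) => /=; last by rewrite big1 // => d _; rewrite big1.
case: (last c s != c) => /=; last first.
  by rewrite mulr0 big1 // => d _; rewrite big1 // => t _; rewrite andbF.
rewrite mulr_sumr [RHS]big_mkcond; apply: eq_bigr => d _ /=.
case: ifP => _; last by rewrite big1 // => t _; rewrite andbF.
rewrite -tail_sum_tuple !mulr_sumr [RHS]big_mkcond; apply: eq_bigr => t _ /=.
by rewrite andbT; case: ifP => // _; rewrite !mulrA.
Qed.
End Colorings.

(** * Moving the attachment vertices to standard position *)

(** Translation by [u] modulo [m + 1] commutes with the successor map; it sends the predecessor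
    [ord_max] of 0 to the predecessor [v] of [u]. *)
Lemma rotate_cycle m (u v : 'I_m.+1) : u = ordS v ->
  exists f : 'I_m.+1 -> 'I_m.+1, [/\ injective f, f ord0 = u, f ord_max = v &
    forall i j, cycle_adj (f i) (f j) = cycle_adj i j].
Proof.
move=> uv; pose f (i : 'I_m.+1) : 'I_m.+1 := u + i.
have f_inj : injective f by exact: addrI.
have fS i : f (ordS i) = ordS (f i).
  by apply: val_inj; rewrite /= modnDmr addnS -[in RHS]addn1 modnDml addn1.
have f0 : f ord0 = u by rewrite /f addr0.
exists f; split=> // [|i j]; last by rewrite /cycle_adj -!fS !(inj_eq f_inj).
have SK : injective (@ordS m.+1) by exact: ordS_inj.
apply: SK; rewrite -fS -uv -[RHS]f0; congr f.
by apply: val_inj; rewrite /= modnn.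
Qed.

Lemma orient_path l (w : 'I_l.+1) : path_end w ->
  exists g : 'I_l.+1 -> 'I_l.+1, [/\ injective g, g ord0 = w &
    forall i j, path_adj (g i) (g j) = path_adj i j].
Proof.
case/orP => /eqP wE.
  by exists id; split=> //; apply: val_inj; rewrite /= wE.
exists (@rev_ord l.+1); split; first exact: rev_ord_inj.
  by apply: val_inj; rewrite /= subn1; case: wE.
move=> i j; rewrite /path_adj /=; have := ltn_ord i; have := ltn_ord j; lia.
Qed.

Lemma line_tadpole_iso m l (u v : 'I_m.+1) (w : 'I_l.+1) :
  cycle_adj u v -> path_end w ->
  exists2 f, bijective f & forall a b,
    line_tadpole_adj u v w (f a) (f b) =
    line_tadpole_adj (ord0 : 'I_m.+1) ord_max (ord0 : 'I_l.+1) a b.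
Proof.
(* Adjacent vertices are successive in one of the two orders, and the graph is symmetric in [u] and
   [v]. *)
wlog uv : u v / u = ordS v => [wlog_uv|] uv_adj w_end.
  case/orP: (uv_adj) => /eqP uv; last exact: wlog_uv.
  have [|f f_bij f_adj] := wlog_uv v u uv _ w_end; first by rewrite /cycle_adj orbC.
  by exists f => // a b; rewrite -f_adj; case: (f a) (f b) => [?|?] [?|?] //=;
    rewrite orbC.
have [f [f_inj f0 fmax f_adj]] := rotate_cycle uv.
have [g [g_inj g0 g_adj]] := orient_path w_end.
pose h (a : 'I_m.+1 + 'I_l.+1) : 'I_m.+1 + 'I_l.+1 :=
  match a with inl i => inl (f i) | inr j => inr (g j) end.
exists h; first by apply: injF_bij => -[i|i] [j|j] //= [] => [/f_inj|/g_inj] ->.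
by move=> [i|i] [j|j] //=; rewrite -f0 -fmax -g0 !inj_eq.
Qed.

(** * Positivity and passage to infinitely many variables *)

Section UniformPositivity.
Variables (R : comNzRingType) (T : Type) (K : T -> finType) (x : forall t, K t -> R).
Let e t := nth 0 (elem_poly (@x t)).

(* The expansion into products of elementary symmetric polynomials has to be
   the same for all alphabets [x t]: otherwise it would not survive the passage
   to infinitely many variables. *)
Definition e_pos (F : T -> R) :=
  exists s : seq (seq nat), forall t, F t = \sum_(I <- s) \prod_(i <- I) e t i.

Lemma eq_e_pos F G : F =1 G -> e_pos F -> e_pos G.
Proof. by move=> FG [s Fs]; exists s => t; rewrite -FG. Qed.

Lemma e_pos_elem i : e_pos (fun t => e t i).
Proof. by exists [:: [:: i]] => t; rewrite !big_seq1. Qed.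

Lemma e_pos0 : e_pos (fun=> 0).
Proof. by exists [::] => t; rewrite big_nil. Qed.

Lemma e_pos1 : e_pos (fun=> 1).
Proof. by exists [:: [::]] => t; rewrite big_seq1 big_nil. Qed.

Lemma e_posD F G : e_pos F -> e_pos G -> e_pos (fun t => F t + G t).
Proof. by case=> s Fs [s' Gs']; exists (s ++ s') => t; rewrite Fs Gs' big_cat. Qed.

Lemma e_posM F G : e_pos F -> e_pos G -> e_pos (fun t => F t * G t).
Proof.
case=> s Fs [s' Gs']; exists (allpairs cat s s') => t.
rewrite Fs Gs' big_allpairs_dep mulr_suml; apply: eq_bigr => I _.
by rewrite mulr_sumr; apply: eq_bigr => J _; rewrite big_cat.
Qed.

Lemma e_pos_sum n (F : nat -> T -> R) : (forall i, (i < n)%N -> e_pos (F i)) ->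
  e_pos (fun t => \sum_(i < n) F i t).
Proof.
elim: n => [|n IH] F_pos.
  by apply: eq_e_pos e_pos0 => t; rewrite big_ord0.
apply: (eq_e_pos (F := fun t => \sum_(i < n) F i t + F n t)).
  by move=> t; rewrite big_ord_recr.
by apply: e_posD; [apply: IH => i /ltnW|]; apply: F_pos.
Qed.

Lemma e_posMn F n : e_pos F -> e_pos (fun t => F t *+ n).
Proof.
move=> F_pos; apply: (eq_e_pos (F := fun t => \sum_(i < n) F t)).
  by move=> t; rewrite sumr_const card_ord.
exact: (e_pos_sum (F := fun=> F)).
Qed.

Lemma e_pos_composition_gf k n : e_pos (fun t => (composition_gf (@x t) k)`_n).
Proof.
apply: (eq_e_pos (F := fun t => \sum_(j < k) (composition_base (@x t) ^+ j)`_n)).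
  by move=> t; rewrite coef_sum.
apply: (e_pos_sum (F := fun j t => (composition_base (@x t) ^+ j)`_n)) => j _.
elim: j n => [|j IH] n.
  apply: (eq_e_pos (F := fun t => (n == 0)%:R)); first by move=> t; rewrite coef1.
  exact/e_posMn/e_pos1.
apply: (eq_e_pos (F := fun t => \sum_(i < n.+1)
    (composition_base (@x t))`_i * (composition_base (@x t) ^+ j)`_(n - i))).
  by move=> t; rewrite exprS coefM.
apply: (e_pos_sum (F := fun i t =>
  (composition_base (@x t))`_i * (composition_base (@x t) ^+ j)`_(n - i))) => i _.
apply: e_posM => //; apply: (eq_e_pos (F := fun t => e t i *+ i.-1)).
  by move=> t; rewrite coef_composition_base.
exact/e_posMn/e_pos_elem.
Qed.

Lemma e_pos_path_sum n : e_pos (fun t => path_sum (@x t) n).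
Proof.
case: n => [|n]; first exact: e_pos1.
pose F j t := e t j.+1 *+ j.+1 * (composition_gf (@x t) n.+2)`_(n - j).
apply: (eq_e_pos (F := fun t => \sum_(j < n.+1) F j t)).
  by move=> t; rewrite (@path_sum_composition _ _ _ n.+2).
apply: e_pos_sum => j _; apply/e_posM/e_pos_composition_gf.
exact/e_posMn/e_pos_elem.
Qed.

Lemma e_pos_crossing_sum l j : e_pos (fun t => crossing_sum (@x t) l j).
Proof.
elim: l j => [|l IH] j; first exact/e_posMn/e_pos_elem.
apply: e_posD => //; apply: e_posM; first exact: e_pos_path_sum.
exact/e_posMn/e_pos_elem.
Qed.

Lemma e_pos_line_tadpole_sum m l :
  e_pos (fun t => line_tadpole_sum (@x t) m.+1 l.+1).
Proof.
(* The least truncation order that [line_tadpole_sum_crossing] admits; it is the same for every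
   alphabet. *)
pose k := (m + l).+3; pose H t j := (composition_gf (@x t) k)`_(m - j).
pose F j t := crossing_sum (@x t) l j.+1 *+ (2 * j) * H t j.
pose G j t := e t j.+1 *+ (j * j.-1) * H t j.
apply: (eq_e_pos (F := fun t => \sum_(j < m.+1) F j t +
  path_sum (@x t) l.+1 * \sum_(j < m.+1) G j t)).
  by move=> t; rewrite (@line_tadpole_sum_crossing _ _ _ k).
apply: e_posD; first apply: e_pos_sum => j _.
  by apply/e_posM/e_pos_composition_gf; exact/e_posMn/e_pos_crossing_sum.
apply: e_posM; first exact: e_pos_path_sum.
apply: e_pos_sum => j _; apply/e_posM/e_pos_composition_gf.
exact/e_posMn/e_pos_elem.
Qed.
End UniformPositivity.

(** * Comparison of series with polynomials in the first [N] variables *)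

Lemma fsbigE_seq (M : nmodType) (I : choiceType) (D : set I) (r : seq I) (F : I -> M) :
  uniq r -> (forall i, i \in r -> D i) ->
  (forall i, D i -> i \notin r -> F i = 0) ->
  \sum_(i \in D) F i = \sum_(i <- r) F i.
Proof.
move=> r_uniq rD F0; rewrite (fsbigE r) // big_seq_cond [RHS]big_seq.
by apply: eq_bigl => i; case: (boolP (i \in r)) => //= /rD Di; apply/mem_set.
Qed.

Lemma prod_malgU (R : comNzRingType) (M : conomType) (I : Type) (r : seq I) (f : I -> M) :
  \prod_(i <- r) << f i >> = << \big[mmul/mone]_(i <- r) f i >> :> {malg R[M]}.
Proof.
elim: r => [|i r IH]; first by rewrite !big_nil.
by rewrite !big_cons IH malgM_def fgmulUU mulr1.
Qed.

Section Truncation.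
Let A := {malg rat[monomial]}.
Let x N (i : 'I_N) : A := << ucm (val i) >>.

Definition truncates N (f : series) (F : A) :=
  forall a : monomial, (forall i, i \in finsupp a -> (i < N)%N) -> f a = F@_a.

Lemma prod_ucm (I : Type) (r : seq I) (f : I -> nat) :
  \prod_(i <- r) << ucm (f i) >> = << monom_prod r f >> :> A.
Proof. exact: prod_malgU. Qed.

Lemma truncates_one N : truncates N series_one 1.
Proof. by move=> a _; rewrite mcoeff1. Qed.

(** Divisors of a monomial in the first [N] variables again involve only these, so all
    factorizations are seen by [F] and [G]. *)
Lemma truncates_mul N f g F G : truncates N f F -> truncates N g G ->
  truncates N (series_mul f g) (F * G).
Proof.
move=> fF gG a aN; pose r := [seq p <- [seq (b, c) | b <- msupp F, c <- msupp G] |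
  mmul p.1 p.2 == a].
have -> : series_mul f g a = \sum_(p <- r) F@_p.1 * G@_p.2.
  rewrite /series_mul (fsbigE_seq (r := r)).
  - apply: eq_big_seq => -[b c]; rewrite mem_filter /= => /andP[/eqP bca _].
    by rewrite fF ?gG // => i ib; apply: aN; rewrite -bca mdomD in_fsetU ib ?orbT.
  - rewrite filter_uniq // allpairs_uniq ?fset_uniq // => -[b c] [b' c'] _ _ /= [-> ->] //.
  - by move=> p; rewrite mem_filter => /andP[/eqP].
  - move=> [b c] /= bca; rewrite mem_filter /= bca eqxx /=.
    rewrite fF ?gG //; try by move=> i ib; apply: aN; rewrite -bca mdomD in_fsetU ib ?orbT.
    apply: contraNeq; rewrite mulf_eq0 negb_or !mcoeff_neq0 => /andP[bF cG].
    by apply/allpairsP; exists (b, c).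
rewrite mcoeffMl big_filter big_mkcond big_allpairs_dep /=.
by apply: eq_bigr => b _; apply: eq_bigr => c _; case: eqP.
Qed.

(** Serves colorings and increasing tuples alike: [h] enumerates the indices whose monomials use
    only the first [N] variables. *)
Lemma truncates_monom_sum N (J : finType) (P : pred J) (I : choiceType)
    (h : J -> I) (D : set I) (mon : I -> monomial) :
  {in P &, injective h} -> (forall j, P j -> D (h j)) ->
  (forall i, D i -> (forall v, v \in finsupp (mon i) -> (v < N)%N) ->
     exists2 j, P j & h j = i) ->
  truncates N (monom_sum D mon) (\sum_(j | P j) << mon (h j) >>).
Proof.
move=> h_inj hD h_surj a aN; rewrite /monom_sum.
rewrite (fsbigE_seq (r := [seq h j | j <- index_enum J & P j && (mon (h j) == a)])).
- rewrite raddf_sum /= big_map big_filter big_mkcondr /=.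
  by apply: eq_bigr => j _; rewrite mcoeffU1; case: eqP.
- rewrite map_inj_in_uniq ?filter_uniq ?index_enum_uniq // => j j'.
  by rewrite !mem_filter => /andP[/andP[Pj _] _] /andP[/andP[Pj' _] _]; apply: h_inj.
- move=> i /mapP[j]; rewrite mem_filter => /andP[/andP[Pj /eqP ja] _] ->.
  by split; first exact: hD.
- move=> i [Di mia] /negP[]; have [|j Pj hj] := h_surj i Di; first by rewrite mia.
  by apply/mapP; exists j; rewrite // mem_filter mem_index_enum hj mia Pj eqxx.
Qed.

Lemma truncates_chromatic N (V : finType) (adj : rel V) :
  truncates N (chromatic_symfun adj) (chromatic_sum (@x N) adj).
Proof.
pose h (k : {ffun V -> 'I_N}) := [ffun v => val (k v)].
have -> : chromatic_sum (@x N) adj =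
    \sum_(k : {ffun V -> 'I_N} | properb adj k) << monom_prod (enum V) (h k) >>.
  apply: eq_bigr => k _; rewrite -prod_ucm big_enum.
  by apply: eq_bigr => v _; rewrite ffunE.
apply: truncates_monom_sum.
- move=> k k' _ _ /ffunP kk'; apply/ffunP => v; apply: val_inj.
  by have := kk' v; rewrite !ffunE.
- move=> k /properbP kP v w /kP; rewrite !ffunE => kvw /val_inj kE.
  by rewrite kE eqxx in kvw.
move=> k kP kN; have kltN v : (k v < N)%N.
  by apply: kN; rewrite monom_prod_mem // mem_enum.
exists [ffun v => Ordinal (kltN v)]; last by apply/ffunP => v; rewrite !ffunE.
by apply/properbP => v w /kP kvw; rewrite !ffunE; apply/eqP => /(congr1 val).
Qed.

Lemma coef_elem_poly (R : comNzRingType) (K : finType) (y : K -> R) n :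
  (elem_poly y)`_n = \sum_(B : {set K} | #|B| == n) \prod_(c in B) y c.
Proof.
rewrite /elem_poly; under eq_bigr => c _ do rewrite addrC.
rewrite bigA_distr coef_sum [RHS]big_mkcond; apply: eq_bigr => B _.
rewrite -big_mkcond big_split /= prodr_const -rmorph_prod coefCM coefXn eq_sym.
by case: eqP; rewrite ?mulr1 ?mulr0.
Qed.

Lemma truncates_elem N n : truncates N (elem n) (elem_poly (@x N))`_n.
Proof.
(* The default tuple is never reached, since only sets [B] of size [n] occur in the sum. *)
pose h (B : {set 'I_N}) : n.-tuple nat := insubd (nseq_tuple n 0%N) (map val (enum B)).
have hE (B : {set 'I_N}) : #|B| == n -> h B = map val (enum B) :> seq nat.
  by move=> Bn; rewrite val_insubd size_map -cardE Bn.
have sortedB (B : {set 'I_N}) : sorted ltn (map val (enum B)).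
  rewrite /enum_mem sorted_map sorted_filter; first by [].
    by move=> i j k; apply: ltn_trans.
  by rewrite -enumT -sorted_map val_enum_ord iota_ltn_sorted.
rewrite coef_elem_poly.
have -> : \sum_(B : {set 'I_N} | #|B| == n) \prod_(c in B) x c =
    \sum_(B : {set 'I_N} | #|B| == n) << monom_prod (h B) id >>.
  apply: eq_bigr => B Bn; rewrite -prod_ucm hE // big_map big_enum.
  by [].
apply: (truncates_monom_sum (mon := fun t : n.-tuple nat => monom_prod t id)).
- move=> B B' Bn B'n /(congr1 (@tval n nat)); rewrite !hE // => /(inj_map val_inj) BB'.
  by apply/setP => i; rewrite -mem_enum BB' mem_enum.
- by move=> B Bn /=; rewrite hE.
move=> t /= tS tN; have tltN i : i \in t -> (i < N)%N.
  by move=> it; apply: tN; rewrite (monom_prod_mem id).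
pose B := [set i : 'I_N | val i \in (t : seq nat)].
have BE : map val (enum B) = t.
  apply: (irr_sorted_eq ltn_trans ltnn) => // i; apply/mapP/idP.
    by case=> j; rewrite mem_enum inE => jt ->.
  by move=> it; exists (Ordinal (tltN i it)); rewrite ?mem_enum ?inE.
have Bn : #|B| == n by rewrite cardE -(size_map val) BE size_tuple.
by exists B => //; apply: val_inj; rewrite -[RHS]BE -hE.
Qed.

(** Dropping zeros and sorting keep the product, as [e_0 = 1] and multiplication commutes. *)
Definition intpart_of (I : seq nat) : seq nat := sort geq [seq i <- I | i != 0%N].

Lemma intpart_of_proof I : is_intpart (intpart_of I).
Proof.
rewrite /is_intpart /intpart_of sort_sorted; last by move=> i j; apply: leq_total.
by rewrite mem_sort mem_filter.
Qed.

Definition to_intpart I : intpart := exist (fun s => is_intpart s) _ (intpart_of_proof I).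

Lemma truncates_elem_part N I : truncates N (elem_part (to_intpart I))
  (\prod_(i <- I) (elem_poly (@x N))`_i).
Proof.
have -> : \prod_(i <- I) (elem_poly (@x N))`_i =
    \prod_(i <- val (to_intpart I)) (elem_poly (@x N))`_i.
  rewrite /= (perm_big _ (permEl (perm_sort _ _))) big_filter [RHS]big_mkcond.
  by apply: eq_bigr => i _; case: eqP => // ->; rewrite elem_poly0.
rewrite /elem_part; elim: (val _) => [|i r IH]; first by rewrite !big_nil; apply: truncates_one.
by rewrite !big_cons; apply: truncates_mul => //; apply: truncates_elem.
Qed.

(** A given monomial involves finitely many variables, so its coefficient can be read off for a
    suitable [N]; as [s] serves all [N], one family of multiplicities [c] works for every
    monomial. *)
Lemma e_positive_of_e_pos (V : finType) (adj : rel V) :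
  e_pos x (fun N => chromatic_sum (@x N) adj) -> e_positive adj.
Proof.
case=> s sE; pose r := map to_intpart s.
pose c : {fsfun intpart -> rat with 0} :=
  [fsfun la in seq_fset tt r => (count_mem la r)%:R | 0].
have cE la : c la = (count_mem la r)%:R.
  by rewrite fsfunE seq_fsetE; case: ifPn => // /count_memPn ->.
exists c; split=> [a|la]; last by rewrite cE ler0n.
have [N aN] := finsupp_ubound a.
rewrite (truncates_chromatic adj aN) sE raddf_sum /=.
transitivity (\sum_(la <- r) elem_part la a).
  by rewrite big_map; apply: eq_bigr => I _; rewrite -(truncates_elem_part I aN).
rewrite -big_undup_iterop_count.
rewrite (perm_big (finsupp c)).
  by apply: eq_bigr => la _; rewrite cE mulr_natl.
apply: uniq_perm; rewrite ?undup_uniq ?fset_uniq // => la.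
by rewrite mem_undup mem_finsupp cE pnatr_eq0 -lt0n -has_count has_pred1.
Qed.
End Truncation.

Theorem corollary3p4 (m l : nat) (hm : (3 <= m)%N) (hl : (1 <= l)%N)
    (u v : 'I_m) (huv : cycle_adj u v) (w : 'I_l) (hw : path_end w) :
  e_positive (line_tadpole_adj u v w).
Proof.
case: m hm u v huv => // m _ u v huv; case: l hl w hw => // l _ w hw.
have [f f_bij f_adj] := line_tadpole_iso huv hw.
apply: e_positive_of_e_pos; apply: eq_e_pos (e_pos_line_tadpole_sum _ m l) => N.
by rewrite -(chromatic_sum_iso _ f_bij f_adj) chromatic_line_tadpole.
Qed.
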